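(* Let $n,d$ be positive integers with $\lfloor 2n/3\rfloor+1\le d\le n$. Then $P(n,d)=n+1$.
   Context: A binary sequence $s=s_0\cdots s_{N-1}$ is an $(n,d)$-robust positioning sequence if for all $0\le i<j\le N-n$ the Hamming distance between $s_i\cdots s_{i+n-1}$ and $s_j\cdots s_{j+n-1}$ is at least $d$. $P(n,d)$ denotes the maximum length $N$ of a binary $(n,d)$-robust positioning sequence. *)

(* Defs.v *)
From mathcomp Require Import all_boot.

Set Implicit Arguments.
Unset Strict Implicit.
Unset Printing Implicit Defensive.

Definition hamming (u v : seq bool) : nat :=
  count (fun p => p.1 != p.2) (zip u v).

Definition window (n : nat) (s : seq bool) (i : nat) : seq bool :=
  take n (drop i s).

(* If size s < n, the truncated difference leaves only j = 0, hence no i < j: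
   the condition is then vacuous, as it is for 0 <= i < j <= N - n < 0. *)
Definition robust (n d : nat) (s : seq bool) : bool :=
  [forall j : 'I_(size s - n).+1, forall i : 'I_j,
     d <= hamming (window n s i) (window n s j)].

Lemma robustP n d s :
  reflect (forall i j, i < j <= size s - n ->
             d <= hamming (window n s i) (window n s j))
          (robust n d s).
Proof.
apply: (iffP forallP) => [H i j /andP[ij jn] | H j].
  by have /forallP/(_ (Ordinal ij)) := H (Ordinal (jn : j < (size s - n).+1)).
by apply/forallP => i; apply: H; rewrite ltn_ord -ltnS ltn_ord.
Qed.

Definition robust_length (n d N : nat) : bool :=
  [exists s : N.-tuple bool, robust n d s].

Lemma robust_length_ex n d : exists N, robust_length n d N.
Proof.
exists 0; apply/existsP; exists [tuple]; apply/robustP => i j.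
by rewrite sub0n leqn0 => /andP[/[swap] /eqP->].
Qed.

Lemma hamming_refl u : hamming u u = 0.
Proof. by elim: u => //= b u IHu; rewrite /hamming /= eqxx; exact: IHu. Qed.

Lemma robust_length_bound n d :
  0 < d -> forall N, robust_length n d N -> N <= n + 2 ^ n.
Proof.
move=> d0 N /existsP[s /robustP]; rewrite size_tuple => H.
have [Nn | nN] := leqP N n; first exact: leq_trans Nn (leq_addr _ _).
have szw (i : 'I_(N - n).+1) : size (window n s i) == n.
  have iN : i + n <= N by rewrite addnC -leq_subRL ?(ltnW nN) // -ltnS ltn_ord.
  by rewrite size_takel // size_drop size_tuple -(leq_add2l i) subnKC
    // (leq_trans _ iN) ?leq_addr.
have inj : injective (fun i => Tuple (szw i)).
  have neq (i j : 'I_(N - n).+1) : i < j -> window n s i <> window n s j.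
    move=> ij e; have := H i j; rewrite ij -ltnS ltn_ord e hamming_refl.
    by move=> /(_ isT); rewrite leqNgt d0.
  move=> i j /(congr1 val) /= e; apply: val_inj => /=.
  by case: (ltngtP i j) => // ij; [case: (neq _ _ ij) | case: (neq _ _ ij)].
have := leq_card _ inj; rewrite card_ord card_tuple card_bool => /ltnW.
by rewrite leq_subLR.
Qed.

(* For d = 0 every length is realized and there is no maximum, hence the
   positivity argument. *)
Definition P (n d : nat) (d_gt0 : 0 < d) : nat :=
  ex_maxn (robust_length_ex n d) (robust_length_bound d_gt0).

Arguments P : clear implicits.

(* Main.v *)
Require Import Defs.
From mathcomp Require Import all_boot.
From mathcomp Require Import zify.

(** A position of three binary words contributes to at most two of their three
    pairwise Hamming distances, so three windows of length [n] at pairwise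
    distance at least [d] force [3 * d <= 2 * n]. Hence there are at most two
    windows, and the alternating word attains this, its two windows being
    complementary. *)

Lemma hamming_cons a b u v : hamming (a :: u) (b :: v) = (a != b) + hamming u v.
Proof. by []. Qed.

Lemma hamming_nils u : hamming u [::] = 0.
Proof. by case: u. Qed.

Lemma hamming_le_size u v : hamming u v <= size v.
Proof. by apply: leq_trans (count_size _ _) _; rewrite size_zip geq_minr. Qed.

Lemma hamming_map_negb u : hamming u (map negb u) = size u.
Proof. by elim: u => //= b u IHu; rewrite hamming_cons IHu; case: b. Qed.

(** Upper bounds on the sizes suffice because [zip] truncates, so windows need no range check. *)
Lemma hamming_triple n u v w : size u <= n -> size v <= n -> size w <= n ->
  hamming u v + hamming u w + hamming v w <= 2 * n.
Proof.
move=> su sv sw.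
(* These bounds settle [n = 0] and the case of an empty word, where at least two of the distances
   vanish. *)
have := hamming_le_size u v; have := hamming_le_size u w.
have := hamming_le_size v w; move: su sv sw.
elim: n u v w => [|n IHn] u v w su sv sw; first by lia.
case: u v w su sv sw => [|a u] [|b v] [|c w]; rewrite ?hamming_nils //=;
  try by rewrite /hamming /=; lia.
rewrite !ltnS !hamming_cons => su sv sw _ _ _.
have := IHn u v w su sv sw; rewrite !hamming_le_size => /(_ isT isT isT).
by case: a b c => [] [] []; lia.
Qed.

Lemma size_window n s i : size (window n s i) <= n.
Proof. by rewrite size_take_min geq_minl. Qed.

Lemma robust_length_succ n d : d <= n -> robust_length n d n.+1.
Proof.
move=> dn; apply/existsP; exists (mktuple (fun i : 'I_n.+1 => odd i)).
have -> : tval (mktuple (fun i : 'I_n.+1 => odd i)) = mkseq odd n.+1.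
  by rewrite /= /mkseq -val_enum_ord -map_comp.
apply/robustP => i j; rewrite size_mkseq subSnn.
(* Only the pair [i = 0], [j = 1] survives. *)
case: j i => [|[|j]] [|i] //; last by rewrite andbF.
move=> _; apply: leq_trans dn _.
have -> : window n (mkseq odd n.+1) 0 = mkseq odd n.
  by rewrite /window drop0 /mkseq -map_take take_iota (minn_idPl (leqnSn n)).
suff -> : window n (mkseq odd n.+1) 1 = map negb (mkseq odd n).
  by rewrite hamming_map_negb size_mkseq.
rewrite /window /mkseq /= drop0 take_oversize ?size_map ?size_iota //.
(* Shifting the index by one flips its parity. *)
by rewrite (iotaDl 1 0) -!map_comp; apply: eq_map.
Qed.

Lemma robust_length_le n d N :
  2 * n < 3 * d -> robust_length n d N -> N <= n.+1.
Proof.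
move=> nd /existsP[s /robustP]; rewrite size_tuple => sP.
(* A length of at least [n + 2] admits the starts 0, 1 and 2. *)
rewrite leqNgt; apply/negP => nN.
have := hamming_triple _ _ _ _ (size_window n s 0) (size_window n s 1)
  (size_window n s 2).
have h01 : d <= hamming (window n s 0) (window n s 1) by apply: sP; lia.
have h02 : d <= hamming (window n s 0) (window n s 2) by apply: sP; lia.
have h12 : d <= hamming (window n s 1) (window n s 2) by apply: sP; lia.
lia.
Qed.

Theorem theorem7p2 (n d : nat) (n_gt0 : 0 < n) (d_gt0 : 0 < d)
    (d_lb : (2 * n) %/ 3 + 1 <= d) (d_ub : d <= n) :
  P n d d_gt0 = n + 1.
Proof.
rewrite addn1 /P; case: ex_maxnP => N rN maxN.
apply/eqP; rewrite eqn_leq maxN ?robust_length_succ // andbT.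
(* The floor bound [d_lb] amounts to [2 * n < 3 * d]. *)
by apply: (robust_length_le _ _ _ _ rN); lia.
Qed.
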